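(* Let $D\ge 2$, let $N_k\in\mathbb{R}^D$ be a unit vector whose first component is zero, $N_k^T=(0,\vec N^T)$ with $\vec N\in\mathbb{R}^{D-1}$, let $Q$ be an orthogonal $D\times D$ matrix with $QN_k=(-1,0,\ldots,0)^T$, and let $\sigma$ be a nonsingular lower triangular real $D\times D$ matrix. Write $$Q=\begin{pmatrix}Q_{11}&\vec q_1^{\,T}\\ \vec q_2&Q_*\end{pmatrix},\qquad \sigma=\begin{pmatrix}\sigma_{11}&\vec 0^{\,T}\\ \vec s&\sigma_*\end{pmatrix},\qquad \vec w=\sigma_{11}\vec q_2+Q_*\vec s ,$$ with $Q_*,\sigma_*$ of size $(D-1)\times(D-1)$. Let $\vec r\in\mathbb{R}^{D-1}$ be given by $\sigma_*\vec r=\vec N$. Then the $D\times D$ matrix $$Z=\begin{pmatrix} I_{D-1}-\frac{1}{\|\vec r\|^2}\vec r\,\vec r^{\,T} & \frac{\vec r}{\|\vec r\|}\\[2pt] \frac{\vec r^{\,T}}{\|\vec r\|} & 0\end{pmatrix}$$ is orthogonal and satisfies $$Z^T\begin{pmatrix}\sigma_*^TQ_*^T\\ \vec w^{\,T}\end{pmatrix}=\begin{pmatrix}H\\ \vec 0^{\,T}\end{pmatrix}$$ for some $(D-1)\times(D-1)$ matrix $H$. Furthermore, $\Lambda_*:=H^T$, which satisfies $\Lambda_*\Lambda_*^T=\hat A_*$, is given by $$\Lambda_*=Q_*\sigma_*+\frac{1}{\|\vec r\|}\,\vec w\,\vec r^{\,T}.$$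
   Context: Set $A=\sigma\sigma^T$ and $\hat A=QAQ^T$. $\hat A_*$ denotes the $(D-1)\times(D-1)$ submatrix obtained from $\hat A$ by removing its first row and first column; it satisfies $\hat A_*=Q_*\sigma_*\sigma_*^TQ_*^T+\vec w\,\vec w^{\,T}$. $I_{D-1}$ is the identity matrix and $\|\cdot\|$ the Euclidean norm. All numbers are real. Vectors with arrows are column vectors in $\mathbb{R}^{D-1}$. *)

(* Defs.v *)
From mathcomp Require Import all_boot all_order all_algebra.
From mathcomp Require Import reals.

Set Implicit Arguments.
Unset Strict Implicit.
Unset Printing Implicit Defensive.

Import Order.TTheory GRing.Theory Num.Theory.
Local Open Scope ring_scope.

(* The norm of the normed-module structure on matrices is the sup norm, hence
   this separate definition. *)
Definition enorm (R : realType) (n : nat) (v : 'cV[R]_n) : R :=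
  Num.sqrt (\sum_(i < n) v i 0 ^+ 2).

Definition orthogonalmx (R : realType) (n : nat) (M : 'M[R]_n) : Prop :=
  M^T *m M = 1%:M.

Definition Zmx (R : realType) (d : nat) (r : 'cV[R]_d) : 'M[R]_(d + 1) :=
  block_mx (1%:M - (enorm r ^+ 2)^-1 *: (r *m r^T)) ((enorm r)^-1 *: r)
           ((enorm r)^-1 *: r^T)                    0.

(* Main.v *)
Require Import Defs.
From mathcomp Require Import all_boot all_order all_algebra.
From mathcomp Require Import reals.

Set Implicit Arguments.
Unset Strict Implicit.
Unset Printing Implicit Defensive.

Import Order.TTheory GRing.Theory Num.Theory.
Local Open Scope ring_scope.

(** With u the unit vector r / ||r||, the matrix Z is the symmetric involution of
    R^d x R which exchanges u with the last basis vector e and is the identity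
    on the orthogonal complement of the plane spanned by u and e; in particular
    it is orthogonal ([Zmx_orthogonal]).

    Let M be the matrix with the blocks (Q_* sigma_* )^T and w^T on top of each
    other.  The last row of Z^T M = Z M is u^T (Q_* sigma_* )^T, that is, the
    transpose of Q_* sigma_* u = Q_* N / ||r||, and Q_* N = 0 is the lower block
    of the hypothesis Q N_k = - e_1.  This vanishing also removes the projection
    term from the upper rows, which leaves H = (Q_* sigma_* )^T + u w^T.

    As Z is orthogonal, H^T H = (Z M)^T (Z M) = M^T M, which is
    Q_* sigma_* (Q_* sigma_* )^T + w w^T.  The lower blocks of Q sigma being w and
    Q_* sigma_*, this is the lower right block of Q sigma (Q sigma)^T. *)

Lemma enorm_sqr (R : realType) (n : nat) (v : 'cV[R]_n) :
  v^T *m v = (enorm v ^+ 2)%:M.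
Proof.
rewrite sqr_sqrtr; last by apply: sumr_ge0 => i _; exact: sqr_ge0.
rewrite [LHS]mx11_scalar mxE; congr (_%:M).
by apply: eq_bigr => i _; rewrite mxE expr2.
Qed.

Lemma enorm0 (R : realType) (n : nat) : enorm (0 : 'cV[R]_n) = 0.
Proof. by rewrite /enorm big1 ?sqrtr0 // => i _; rewrite mxE expr0n. Qed.

Lemma enorm_eq0 (R : realType) (n : nat) (v : 'cV[R]_n) :
  (enorm v == 0) = (v == 0).
Proof.
apply/eqP/eqP => [|->]; last exact: enorm0.
move=> /eqP; rewrite sqrtr_eq0 => le0.
have /psumr_eq0P v0 : \sum_(i < n) v i 0 ^+ 2 = 0.
  by apply/le_anti; rewrite le0 sumr_ge0 // => i _; exact: sqr_ge0.
apply/matrixP => i j; rewrite ord1 mxE; apply/eqP; rewrite -sqrf_eq0; apply/eqP.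
by apply: v0 => // k _; exact: sqr_ge0.
Qed.

(** The form that [Zmx r] takes once r is normalised: it contains no inverse,
    so that its algebra needs only u^T u = 1.  The upper left block is then the
    projection onto the orthogonal complement of u. *)
Definition swapmx (R : comNzRingType) (d : nat) (u : 'cV[R]_d) : 'M[R]_(d + 1) :=
  block_mx (1%:M - u *m u^T) u u^T 0.

Lemma tr_swapmx (R : comNzRingType) (d : nat) (u : 'cV[R]_d) :
  (swapmx u)^T = swapmx u.
Proof.
by rewrite /swapmx tr_block_mx linearB /= tr_scalar_mx trmx_mul !trmxK trmx0.
Qed.

Lemma swapmx_involutive (R : comNzRingType) (d : nat) (u : 'cV[R]_d) :
  u^T *m u = 1%:M -> swapmx u *m swapmx u = 1%:M.
Proof.
move=> uu.
(* the projection onto the complement of u annihilates u on both sides *)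
have Pu : (1%:M - u *m u^T) *m u = 0.
  by rewrite mulmxBl mul1mx -mulmxA uu mulmx1 subrr.
have uP : u^T *m (1%:M - u *m u^T) = 0.
  by rewrite mulmxBr mulmx1 mulmxA uu mul1mx subrr.
rewrite /swapmx mulmx_block Pu uP uu !mulmx0 !mul0mx !addr0.
by rewrite mulmxBr mulmx1 mulmxA Pu mul0mx subr0 subrK -scalar_mx_block.
Qed.

Lemma Zmx_swapmx (R : realType) (d : nat) (r : 'cV[R]_d) :
  Zmx r = swapmx ((enorm r)^-1 *: r).
Proof.
rewrite /Zmx /swapmx [(_ *: r)^T]linearZ /= -scalemxAl -scalemxAr scalerA.
by rewrite -invfM -expr2.
Qed.

Lemma Zmx_orthogonal (R : realType) (d : nat) (r : 'cV[R]_d) :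
  r != 0 -> orthogonalmx (Zmx r).
Proof.
move=> r0; rewrite /orthogonalmx Zmx_swapmx tr_swapmx swapmx_involutive //.
rewrite [(_ *: r)^T]linearZ /= -scalemxAl -scalemxAr scalerA enorm_sqr scale_scalar_mx.
by rewrite -invfM -expr2 mulVf // expf_neq0 // enorm_eq0.
Qed.

(** Since u^T B^T = 0, the projection in the upper left block fixes B^T and the
    last row of the swap kills it; w^T only meets the last column, which is u
    above and 0 below. *)
Lemma swapmx_compress (R : comNzRingType) (d m : nat) (u : 'cV[R]_d)
    (B : 'M[R]_(m, d)) (w : 'cV[R]_m) :
  B *m u = 0 ->
  swapmx u *m col_mx B^T w^T = col_mx (B + w *m u^T)^T 0.
Proof.
move=> Bu; have uB : u^T *m B^T = 0 by rewrite -trmx_mul Bu trmx0.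
rewrite /swapmx mul_block_col mulmxBl mul1mx -mulmxA uB mulmx0 subr0 mul0mx addr0.
by rewrite linearD /= trmx_mul trmxK.
Qed.

Lemma orthogonal_gram (R : realType) (n m : nat) (Z : 'M[R]_n)
    (M : 'M[R]_(n, m)) :
  orthogonalmx Z -> (Z^T *m M)^T *m (Z^T *m M) = M^T *m M.
Proof.
move=> /mulmx1C ZZ.
by rewrite trmx_mul trmxK mulmxA -[_ *m Z *m Z^T]mulmxA ZZ mulmx1.
Qed.

Lemma row'0_col'0_drsubmx (R : Type) (d : nat) (A : 'M[R]_(1 + d)) :
  row' ord0 (col' ord0 A) = drsubmx A.
Proof.
by apply/matrixP => i j; rewrite !mxE; congr (A _ _); apply/val_inj.
Qed.

Theorem lemma6 (R : realType) (d : nat) (hD : (2 <= 1 + d)%N)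
    (Nk : 'cV[R]_(1 + d)) (N : 'cV[R]_d)
    (hNk : enorm Nk = 1) (hN : Nk = col_mx 0 N)
    (Q : 'M[R]_(1 + d)) (hQ : orthogonalmx Q)
    (hQN : Q *m Nk = col_mx (-1)%:M 0)
    (sigma : 'M[R]_(1 + d))
    (hsigma_unit : sigma \in unitmx) (hsigma_trig : is_trig_mx sigma)
    (Q11 : R) (q1 q2 : 'cV[R]_d) (Qs : 'M[R]_d)
    (hQblock : Q = block_mx Q11%:M q1^T q2 Qs)
    (s11 : R) (s : 'cV[R]_d) (sigmas : 'M[R]_d)
    (hsigmablock : sigma = block_mx s11%:M 0 s sigmas)
    (w : 'cV[R]_d) (hw : w = s11 *: q2 + Qs *m s)
    (r : 'cV[R]_d) (hr : sigmas *m r = N) :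
  let A := sigma *m sigma^T in
  let Ahat := Q *m A *m Q^T in
  let Ahats : 'M[R]_d := row' ord0 (col' ord0 Ahat) in
  orthogonalmx (Zmx r) /\
  exists H : 'M[R]_d,
    (Zmx r)^T *m col_mx (sigmas^T *m Qs^T) w^T = col_mx H 0 /\
    let Lambdas := H^T in
    Lambdas *m Lambdas^T = Ahats /\
    Lambdas = Qs *m sigmas + (enorm r)^-1 *: (w *m r^T).
Proof.
move=> A Ahat Ahats.
have QsN : Qs *m N = 0.
  move: hQN; rewrite hQblock hN mul_block_col !mulmx0 !add0r.
  by case/eq_col_mx.
have r0 : r != 0.
  apply/eqP => r0; have /eqP := hNk.
  by rewrite hN -hr r0 mulmx0 col_mx0 enorm0 eq_sym oner_eq0.
have Zo := Zmx_orthogonal r0.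
have AhatsE : Ahats = Qs *m sigmas *m (Qs *m sigmas)^T + w *m w^T.
  have -> : Ahats = drsubmx (Q *m sigma *m (Q *m sigma)^T).
    by rewrite /Ahats row'0_col'0_drsubmx /Ahat /A trmx_mul !mulmxA.
  rewrite hQblock hsigmablock mulmx_block tr_block_mx mulmx_block block_mxKdr.
  by rewrite mulmx0 add0r mul_mx_scalar -hw addrC.
have ZM : (Zmx r)^T *m col_mx (sigmas^T *m Qs^T) w^T =
    col_mx (Qs *m sigmas + (enorm r)^-1 *: (w *m r^T))^T 0.
  rewrite Zmx_swapmx tr_swapmx -trmx_mul swapmx_compress.
    by rewrite [(_ *: r)^T]linearZ /= -scalemxAr.
  by rewrite -scalemxAr -mulmxA hr QsN scaler0.
split=> //; exists (Qs *m sigmas + (enorm r)^-1 *: (w *m r^T))^T.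
split=> //; split; last exact: trmxK.
have := orthogonal_gram (col_mx (sigmas^T *m Qs^T) w^T) Zo.
rewrite ZM !tr_col_mx !mul_row_col trmx0 mul0mx addr0.
by rewrite AhatsE -[sigmas^T *m _]trmx_mul !trmxK => ->.
Qed.
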